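(* Let $\mu$ be a finite positive Borel measure on $[0,1]$ with $\mu(\{0\})=\mu(\{1\})$, and let $m_k=\int_{[0,1]}e^{i2\pi\theta k}\,d\mu(\theta)$, $k\in\mathbb{Z}$. For $N\in\mathbb{N}$ define $$S_n(\theta)=\sum_{k=-n}^{n}e^{i2\pi\theta k}\,\overline{m_k},\qquad \rho_N^{\mathrm{CS}}(\theta)=\frac{1}{N+1}\sum_{n=0}^{N}S_n(\theta),$$ let $\mu_N^{\mathrm{CS}}$ be the measure on $[0,1]$ with density $\rho_N^{\mathrm{CS}}$, i.e. $\mu_N^{\mathrm{CS}}([a,b])=\int_a^b\rho_N^{\mathrm{CS}}(\theta)\,d\theta$ for $0\le a\le b\le 1$, and let $F_N^{\mathrm{CS}}(t)=\int_0^t\rho_N^{\mathrm{CS}}(\theta)\,d\theta$ be its distribution function. Then $F_N^{\mathrm{CS}}(0)=0$, $F_N^{\mathrm{CS}}(1)=\mu([0,1])$ and $$\lim_{N\to\infty}F_N^{\mathrm{CS}}(t)=\frac{F(t)+F^-(t)}{2},\qquad t\in(0,1),$$ where $F(t)=\mu([0,t])$ is the right-continuous distribution function of $\mu$ and $F^-(t)=\mu([0,t))$ is its left limit at $t$. In particular, $\mu_N^{\mathrm{CS}}$ converges weakly to $\mu$.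
   Context: A sequence of measures $(\mu_N)$ converges weakly to $\mu$ if $\int f\,d\mu_N\to\int f\,d\mu$ for all continuous bounded functions $f$. *)

(* Defs.v *)
From HB Require Import structures.
From mathcomp Require Import all_boot all_order all_algebra.
From mathcomp Require Import all_classical all_reals all_analysis.
From mathcomp Require Import measurable_realfun complex.
From mathcomp Require Import ring lra zify.

Set Implicit Arguments.
Unset Strict Implicit.
Unset Printing Implicit Defensive.

Import Order.TTheory GRing.Theory Num.Theory.
Import numFieldNormedType.Exports.

Local Open Scope classical_set_scope.
Local Open Scope ring_scope.
Local Open Scope complex_scope.

Definition expi {R : realType} (x : R) : R[i] := cos x +i* sin x.

Definition Cintegral {R : realType}
    (mu : {finite_measure set (measurableTypeR R) -> \bar R})
    (D : set R) (f : R -> R[i]) : R[i] :=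
  (\int[mu]_(x in D) complex.Re (f x)) +i* (\int[mu]_(x in D) complex.Im (f x)).

Definition moment {R : realType}
    (mu : {finite_measure set (measurableTypeR R) -> \bar R})
    (k : int) : R[i] :=
  Cintegral mu `[0, 1] (fun theta => expi (2 * pi * theta * k%:~R)).

(* The index j of the sum encodes k = j - n, which ranges over -n, ..., n. *)
Definition fourier_sum {R : realType}
    (mu : {finite_measure set (measurableTypeR R) -> \bar R})
    (n : nat) (theta : R) : R[i] :=
  \sum_(j < (2 * n).+1)
    (let k := (j : nat)%:Z - n%:Z in
     expi (2 * pi * theta * k%:~R) * (moment mu k)^*).

Definition cesaro_sum {R : realType}
    (mu : {finite_measure set (measurableTypeR R) -> \bar R})
    (N : nat) (theta : R) : R[i] :=
  N.+1%:R^-1 * \sum_(n < N.+1) fourier_sum mu n theta.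

(* For a positive measure mu, cesaro_sum mu N takes nonnegative real values
   (lemma cesaro_sum_ge0, where <= is the order of R[i], which compares only
   numbers with the same imaginary part). *)
Definition cesaro_density {R : realType}
    (mu : {finite_measure set (measurableTypeR R) -> \bar R})
    (N : nat) (theta : R) : R :=
  complex.Re (cesaro_sum mu N theta).


Lemma sum_symmetric_even (V : zmodType) (g : int -> V) (n : nat) :
  (forall k, g (- k) = g k) ->
  \sum_(j < (2 * n).+1) g ((j : nat)%:Z - n%:Z) =
  g 0 + (\sum_(k < n) g k.+1%:Z) *+ 2.
Proof.
move=> gN; elim: n => [|n IH].
  by rewrite muln0 big_ord1 big_ord0 mul0rn !addr0.
rewrite (_ : (2 * n.+1).+1 = (2 * n).+3)%N; last by rewrite mulnS.
rewrite big_ord_recl big_ord_recr/= sub0r gN.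
rewrite (_ : (bump 0 (2 * n).+1)%:Z - n.+1%:Z = n.+1%:Z); last first.
  by rewrite /bump leq0n; lia.
have -> : \sum_(i < (2 * n).+1) g ((bump 0 i)%:Z - n.+1%:Z) =
    \sum_(j < (2 * n).+1) g ((j : nat)%:Z - n%:Z).
  by apply: eq_bigr => i _; congr g; rewrite /bump leq0n; lia.
rewrite IH big_ord_recr/= mulrnDl [LHS]addrC [g n.+1%:Z *+ 2]mulr2n -!addrA.
reflexivity.
Qed.

Lemma fejer_square {R : realType} (N : nat) (x : R) :
  \sum_(n < N.+1) \sum_(j < (2 * n).+1) cos (x * ((j : nat)%:Z - n%:Z)%:~R) =
  (\sum_(j < N.+1) cos (x * j%:R)) ^+ 2 + (\sum_(j < N.+1) sin (x * j%:R)) ^+ 2.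
Proof.
have E n : \sum_(j < (2 * n).+1) cos (x * ((j : nat)%:Z - n%:Z)%:~R) =
    1 + (\sum_(k < n) cos (x * k.+1%:R)) *+ 2.
  rewrite (sum_symmetric_even (g := fun k : int => cos (x * k%:~R))).
    by rewrite mulr0 cos0.
  by move=> k; rewrite mulrNz mulrN cosN.
elim: N => [|N IH].
  rewrite big_ord1 E !big_ord1 big_ord0/= mulr0 cos0 sin0; ring.
rewrite big_ord_recr/= IH E !(big_ord_recr N.+1)/=.
set C := \sum_(j < N.+1) cos _; set S := \sum_(j < N.+1) sin _.
have -> : \sum_(k < N.+1) cos (x * k.+1%:R) =
    cos (x * N.+1%:R) * C + sin (x * N.+1%:R) * S.
  rewrite /C /S !mulr_sumr -big_split/= (reindex_inj rev_ord_inj)/=.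
  apply: eq_bigr => i _; have iN : (i <= N)%N by rewrite -ltnS.
  by rewrite -cosB -mulrBr -natrB 1?leqW// subSS subSn.
have := cos2Dsin2 (x * N.+1%:R).
move: (cos _) (sin _) => c s cs; rewrite -cs; ring.
Qed.

Section density_lemmas.
Context {R : realType}
  (mu : {finite_measure set (measurableTypeR R) -> \bar R}).

Lemma integrable_continuous_bounded (f : R -> R) (M : R) :
  continuous f -> (forall x, `|f x| <= M) ->
  mu.-integrable `[0, 1]%classic (EFin \o f).
Proof.
move=> cf fM; apply: measurable_bounded_integrable => //.
- by rewrite ltey_eq fin_num_measure.
- by apply: measurable_funTS; exact: continuous_measurable_fun.
- exists M; split; rewrite ?num_real// => y My x _ /=.
  exact: le_trans (fM x) (ltW My).
Qed.

Lemma integrable_cos (a b : R) :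
  mu.-integrable `[0, 1]%classic (EFin \o (fun s => cos (a + s * b))).
Proof.
apply: (@integrable_continuous_bounded _ 1) => [x|x]; last exact: cos_max.
apply: continuous_comp; last exact: continuous_cos.
by apply: cvgD; [exact: cvg_cst|apply: cvgM; [exact: cvg_id|exact: cvg_cst]].
Qed.

Lemma Rintegral_sum (I : Type) (r : seq I) (f : I -> R -> R) :
  (forall i, mu.-integrable `[0, 1]%classic (EFin \o f i)) ->
  \int[mu]_(x in `[0, 1]) (\sum_(i <- r) f i x) =
  \sum_(i <- r) \int[mu]_(x in `[0, 1]) f i x.
Proof.
move=> fi; rewrite /Rintegral.
under eq_integral do rewrite -sumEFin.
rewrite integral_sum//.
by rewrite -sum_fine// => i _; apply: integrable_fin_num => //; exact: fi.
Qed.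

Lemma Re_sum (I : Type) (r : seq I) (f : I -> R[i]) :
  complex.Re (\sum_(i <- r) f i) = \sum_(i <- r) complex.Re (f i).
Proof. by apply: (big_morph (@complex.Re R)) => // -[a b] [c d]. Qed.

Lemma Im_sum (I : Type) (r : seq I) (f : I -> R[i]) :
  complex.Im (\sum_(i <- r) f i) = \sum_(i <- r) complex.Im (f i).
Proof. by apply: (big_morph (@complex.Im R)) => // -[a b] [c d]. Qed.

Lemma Re_natVM (n : nat) (z : R[i]) :
  complex.Re (n%:R^-1 * z) = n%:R^-1 * complex.Re z.
Proof.
have -> : n%:R^-1 = (n%:R^-1)%:C :> R[i] by rewrite fmorphV rmorph_nat.
by case: z => a b /=; rewrite mul0r subr0.
Qed.

Lemma Im_natVM (n : nat) (z : R[i]) :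
  complex.Im (n%:R^-1 * z) = n%:R^-1 * complex.Im z.
Proof.
have -> : n%:R^-1 = (n%:R^-1)%:C :> R[i] by rewrite fmorphV rmorph_nat.
by case: z => a b /=; rewrite mul0r addr0.
Qed.

Let c (k : int) := \int[mu]_(s in `[0, 1]) cos (2 * pi * s * k%:~R).
Let d (k : int) := \int[mu]_(s in `[0, 1]) sin (2 * pi * s * k%:~R).

Let cN k : c (- k) = c k.
Proof.
by apply: eq_Rintegral => x _; rewrite mulrNz mulrN cosN.
Qed.

Let dN k : d (- k) = - d k.
Proof.
rewrite -[RHS]mulN1r /d -RintegralZl//; last first.
  apply: (@integrable_continuous_bounded _ 1) => [x|x]; last exact: sin_max.
  apply: continuous_comp; last exact: continuous_sin.
  by apply: cvgM; [apply: cvgM; [exact: cvg_cst|exact: cvg_id]|exact: cvg_cst].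
by apply: eq_Rintegral => x _; rewrite mulrNz mulrN sinN mulN1r.
Qed.

Let Re_term k theta :
  complex.Re (expi (2 * pi * theta * k%:~R) * (moment mu k)^*) =
  cos (2 * pi * theta * k%:~R) * c k + sin (2 * pi * theta * k%:~R) * d k.
Proof. by rewrite /= mulrN opprK. Qed.

Let Im_term k theta :
  complex.Im (expi (2 * pi * theta * k%:~R) * (moment mu k)^*) =
  sin (2 * pi * theta * k%:~R) * c k - cos (2 * pi * theta * k%:~R) * d k.
Proof. by rewrite /= mulrN addrC. Qed.

Let Re_termE k theta :
  complex.Re (expi (2 * pi * theta * k%:~R) * (moment mu k)^*) =
  \int[mu]_(s in `[0, 1]) cos (2 * pi * (theta - s) * k%:~R).
Proof.
have ic : mu.-integrable `[0, 1]%classic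
    (EFin \o (fun s => cos (2 * pi * s * k%:~R))).
  apply: (@integrable_continuous_bounded _ 1) => [x|x]; last exact: cos_max.
  apply: continuous_comp; last exact: continuous_cos.
  by apply: cvgM; [apply: cvgM; [exact: cvg_cst|exact: cvg_id]|exact: cvg_cst].
have is_ : mu.-integrable `[0, 1]%classic
    (EFin \o (fun s => sin (2 * pi * s * k%:~R))).
  apply: (@integrable_continuous_bounded _ 1) => [x|x]; last exact: sin_max.
  apply: continuous_comp; last exact: continuous_sin.
  by apply: cvgM; [apply: cvgM; [exact: cvg_cst|exact: cvg_id]|exact: cvg_cst].
rewrite Re_term /c /d -!RintegralZl//.
rewrite -RintegralD//; first last.
- exact: (integrableZl _ _ is_).
- exact: (integrableZl _ _ ic).
by apply: eq_Rintegral => s _; rewrite mulrBr mulrBl cosB.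
Qed.

Lemma Im_cesaro_sum N theta : complex.Im (cesaro_sum mu N theta) = 0.
Proof.
rewrite /cesaro_sum Im_natVM Im_sum big1 ?mulr0// => n _.
rewrite /fourier_sum Im_sum.
pose h (k : int) :=
  sin (2 * pi * theta * k%:~R) * c k - cos (2 * pi * theta * k%:~R) * d k.
under eq_bigr do rewrite Im_term -/(h _).
set S := LHS; suff : S = - S by lra.
rewrite /S {1}(reindex_inj rev_ord_inj)/= -sumrN; apply: eq_bigr => i _.
have -> : ((2 * n).+1 - i.+1)%N%:Z - n%:Z = - (i%:Z - n%:Z).
  by have := ltn_ord i; lia.
by rewrite /h cN dN mulrNz !mulrN sinN cosN; ring.
Qed.

Lemma cesaro_densityE N theta : cesaro_density mu N theta =
  N.+1%:R^-1 * \int[mu]_(s in `[0, 1])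
    \sum_(n < N.+1) \sum_(j < (2 * n).+1)
      cos (2 * pi * (theta - s) * ((j : nat)%:Z - n%:Z)%:~R).
Proof.
rewrite /cesaro_density /cesaro_sum Re_natVM Re_sum; congr (_ * _).
have ic k : mu.-integrable `[0, 1]%classic
    (EFin \o (fun s => cos (2 * pi * (theta - s) * k%:~R))).
  apply: (@integrable_continuous_bounded _ 1) => [x|x]; last exact: cos_max.
  apply: continuous_comp; last exact: continuous_cos.
  apply: cvgM; last exact: cvg_cst.
  by apply: cvgM; [exact: cvg_cst|apply: cvgB; [exact: cvg_cst|exact: cvg_id]].
rewrite Rintegral_sum.
  apply: eq_bigr => n _; rewrite Rintegral_sum//.
  by rewrite /fourier_sum Re_sum; apply: eq_bigr => j _; rewrite Re_termE.
move=> n; rewrite (_ : _ \o _ = fun s => (\sum_(j < (2 * n).+1)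
    (cos (2 * pi * (theta - s) * ((j : nat)%:Z - n%:Z)%:~R))%:E)%E).
  by apply: integrable_sum => // j _; exact: ic.
by apply/funext => s /=; rewrite sumEFin.
Qed.

Lemma cesaro_density_ge0 N theta : 0 <= cesaro_density mu N theta.
Proof.
rewrite cesaro_densityE mulr_ge0 ?invr_ge0 ?ler0n// Rintegral_ge0// => s _.
by rewrite fejer_square addr_ge0 ?sqr_ge0.
Qed.

Lemma cesaro_sum_ge0 N theta : 0 <= cesaro_sum mu N theta.
Proof. by rewrite lecE Im_cesaro_sum eqxx; exact: cesaro_density_ge0. Qed.

Lemma continuous_cesaro_density N : continuous (cesaro_density mu N).
Proof.
rewrite (_ : cesaro_density mu N = fun theta => N.+1%:R^-1 *
    \sum_(n < N.+1) \sum_(j < (2 * n).+1) (let k := (j : nat)%:Z - n%:Z in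
  cos (2 * pi * theta * k%:~R) * c k + sin (2 * pi * theta * k%:~R) * d k)).
  move=> x; apply: cvgM; first exact: cvg_cst.
  apply: cvg_big => [|n _]; first exact: add_continuous.
  apply: cvg_big => [|j _]; first exact: add_continuous.
  by apply: cvgD; apply: cvgM; try exact: cvg_cst; apply: continuous_comp;
    try exact: continuous_cos; try exact: continuous_sin;
    apply: cvgM; try exact: cvg_cst; apply: cvgM; try exact: cvg_cst;
    exact: cvg_id.
apply/funext => theta; rewrite /cesaro_density /cesaro_sum Re_natVM Re_sum.
congr (_ * _); apply: eq_bigr => n _; rewrite /fourier_sum Re_sum.
by apply: eq_bigr => j _; rewrite Re_term.
Qed.

Lemma integrable_cesaro_density N :
  lebesgue_measure.-integrable `[0, 1]%classic (EFin \o cesaro_density mu N).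
Proof.
apply: continuous_compact_integrable; first exact: segment_compact.
by apply: continuous_subspaceT; exact: continuous_cesaro_density.
Qed.

End density_lemmas.

Definition cesaro_cdf {R : realType}
    (mu : {finite_measure set (measurableTypeR R) -> \bar R})
    (N : nat) (t : R) : R :=
  \int[lebesgue_measure]_(theta in `[0, t]) cesaro_density mu N theta.

Definition cesaro_measure {R : realType}
    (mu : {finite_measure set (measurableTypeR R) -> \bar R}) (N : nat)
    (A : set (measurableTypeR R)) : \bar R :=
  (\int[lebesgue_measure]_(theta in A `&` `[0%R, 1%R])
     (cesaro_density mu N theta)%:E)%E.

Section cesaro_measure_instance.
Context {R : realType}
  (mu : {finite_measure set (measurableTypeR R) -> \bar R})
  (N : nat).

Let m := cesaro_measure mu N.

Let m0 : m set0 = 0%E.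
Proof. by rewrite /m /cesaro_measure set0I integral_set0. Qed.

Let m_ge0 A : (0 <= m A)%E.
Proof.
by apply: integral_ge0 => x _; rewrite lee_fin cesaro_density_ge0.
Qed.

Let m_sigma_additive : semi_sigma_additive m.
Proof.
pose g := (EFin \o cesaro_density mu N) \_ `[0, 1]%classic.
rewrite (_ : m = fun A => (\int[lebesgue_measure]_(x in A) g x)%E).
  apply: semi_sigma_additive_nng_induced => [|x].
    apply/(measurable_restrictT _ _).1; first exact: measurable_itv.
    by case/integrableP : (integrable_cesaro_density mu N).
  by rewrite /g patchE; case: ifP => // _; rewrite lee_fin cesaro_density_ge0.
by apply/funext => A; rewrite /m /cesaro_measure integral_mkcondr.
Qed.

HB.instance Definition _ := isMeasure.Build _ _ _ (cesaro_measure mu N)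
  m0 m_ge0 m_sigma_additive.

Let m_fin : fin_num_fun m.
Proof.
apply: lty_fin_num_fun.
rewrite -[X in (X < _)%E]/(m setT) /m /cesaro_measure setTI.
by rewrite ltey_eq integrable_fin_num//; exact: integrable_cesaro_density.
Qed.

HB.instance Definition _ := Measure_isFinite.Build _ _ _ (cesaro_measure mu N)
  m_fin.

Lemma cesaro_measure_itv (a b : R) : 0 <= a -> a <= b -> b <= 1 ->
  cesaro_measure mu N `[a, b]%classic =
  (\int[lebesgue_measure]_(theta in `[a, b]) cesaro_density mu N theta)%:E.
Proof.
move=> a0 ab b1.
have abS : `[a, b] `<=` `[0, 1 : R].
  by apply: subset_itv; rewrite bnd_simp.
rewrite /cesaro_measure /Rintegral fineK.
  by congr integral; exact/setIidl.
apply: integrable_fin_num => //.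
by apply: integrableS (integrable_cesaro_density mu N).
Qed.

End cesaro_measure_instance.

Definition cdf01 {R : realType}
    (mu : {finite_measure set (measurableTypeR R) -> \bar R})
    (t : R) : R := fine (mu `[0, t]%classic).

Definition cdf01_left {R : realType}
    (mu : {finite_measure set (measurableTypeR R) -> \bar R})
    (t : R) : R := fine (mu `[0, t[%classic).

(* Weak convergence of measures on D: the test functions are the bounded
   continuous functions on the subspace D. *)
Definition weak_cvg_on {R : realType} (D : set R)
    (mu_ : nat -> {finite_measure set (measurableTypeR R) -> \bar R})
    (mu : {finite_measure set (measurableTypeR R) -> \bar R}) : Prop :=
  forall f : R -> R,
    {within D, continuous f} ->
    (exists M : R, forall x, D x -> `|f x| <= M) ->
    \int[mu_ N]_(x in D) f x @[N --> \oo] --> \int[mu]_(x in D) f x.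

(* Main.v *)
(* The Cesaro density is the convolution of mu with the Fejer kernel K_N, which
   is nonnegative with integral 1 over a period and satisfies
   sin^2(pi x) K_N(x) <= 1/(N+1). Integrating in theta first, F_N(t) becomes the
   mu-integral of s |-> P_N(t - s) + P_N(s), where P_N is the odd primitive of
   K_N. Since P_N(1/2) = 1/2, the kernel bound gives P_N(x) -> 1/2 on ]0, 1[, so
   the integrand tends to 1 for 0 < s < t, to 1/2 for s in {0, t, 1} and to 0
   for t < s < 1; dominated convergence and mu {0} = mu {1} yield the mean of F
   and F^-. For a continuous f, the kernel means of f tend to f(s) for s in
   ]0, 1[ and to (f(0) + f(1)) / 2 at both endpoints; again dominated
   convergence and mu {0} = mu {1} yield the weak limit. *)
Require Import Defs.
From HB Require Import structures.
From mathcomp Require Import all_boot all_order all_algebra.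
From mathcomp Require Import all_classical all_reals all_analysis.
From mathcomp Require Import measurable_realfun complex.
From mathcomp Require Import ring lra.

Import Order.TTheory GRing.Theory Num.Theory.
Import numFieldNormedType.Exports.

Local Open Scope classical_set_scope.
Local Open Scope ring_scope.

(** * The Fejer kernel, its primitive and the pointwise bound on the kernel *)

Definition fejer {R : realType} (N : nat) (x : R) : R :=
  N.+1%:R^-1 * \sum_(n < N.+1) \sum_(j < (2 * n).+1)
    cos (2 * pi * x * ((j : nat)%:Z - n%:Z)%:~R).

(** The odd 1-periodic part of the primitive: a mode [2 * cos (2 pi k x)] of the kernel integrates
    to [sin (2 pi k x) / (pi k)], while the constant mode 1 gives the linear term of
    [fejer_primitive]. *)
Definition fejer_remainder {R : realType} (N : nat) (x : R) : R :=
  N.+1%:R^-1 * \sum_(n < N.+1) \sum_(k < n)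
    sin (2 * pi * k.+1%:R * x) / (pi * k.+1%:R).

Definition fejer_primitive {R : realType} (N : nat) (x : R) : R :=
  x + fejer_remainder N x.

Section fejer_kernel.
Context {R : realType}.
Implicit Types (N : nat) (x : R).

Lemma sin_2pi_natDr (n : nat) x :
  sin (2 * pi * n%:R * (x + 1)) = sin (2 * pi * n%:R * x).
Proof.
rewrite mulrDr mulr1 -[RHS](periodicn (@sinD2pi R) n); congr sin.
by rewrite -mulr_natr -[pi *+ 2]mulr_natr; ring.
Qed.

Lemma cos_2pi_natDr (n : nat) x :
  cos (2 * pi * n%:R * (x + 1)) = cos (2 * pi * n%:R * x).
Proof.
rewrite mulrDr mulr1 -[RHS](periodicn (@cosD2pi R) n); congr cos.
by rewrite -mulr_natr -[pi *+ 2]mulr_natr; ring.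
Qed.

(** The frequencies [k] and [-k] pair up, and the zero frequency contributes 1 to each of the [N.+1]
    averaged sums. This form matches [fejer_remainder] term by term. *)
Lemma fejerE N x : fejer N x = 1 + N.+1%:R^-1 *
  \sum_(n < N.+1) \sum_(k < n) (cos (2 * pi * k.+1%:R * x) *+ 2).
Proof.
rewrite /fejer.
under eq_bigr => n _.
  rewrite (sum_symmetric_even (g := fun k : int => cos (2 * pi * x * k%:~R))).
    rewrite mulr0 cos0 -sumrMnl.
    under eq_bigr do rewrite mulrAC.
    over.
  by move=> k; rewrite mulrNz mulrN cosN.
rewrite big_split/= mulrDr sumr_const card_ord -[1 *+ _]/(N.+1%:R).
by rewrite mulVf ?pnatr_eq0.
Qed.

Lemma fejerN N x : fejer N (- x) = fejer N x.
Proof.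
by congr (_ * _); apply: eq_bigr => n _; apply: eq_bigr => j _;
  rewrite mulrN mulNr cosN.
Qed.

Lemma fejerDr N x : fejer N (x + 1) = fejer N x.
Proof.
rewrite !fejerE; congr (1 + _ * _); apply: eq_bigr => n _.
by apply: eq_bigr => k _; rewrite cos_2pi_natDr.
Qed.

Lemma fejer_square_sum N x : fejer N x = N.+1%:R^-1 *
  ((\sum_(j < N.+1) cos (2 * pi * x * j%:R)) ^+ 2 +
   (\sum_(j < N.+1) sin (2 * pi * x * j%:R)) ^+ 2).
Proof. by rewrite /fejer fejer_square. Qed.

Lemma fejer_ge0 N x : 0 <= fejer N x.
Proof.
by rewrite fejer_square_sum mulr_ge0 ?invr_ge0 ?ler0n// addr_ge0 ?sqr_ge0.
Qed.

(** The sum telescopes, because [2 sin x cos (2 x j)] is [sin ((2 j + 1) x) - sin ((2 j - 1) x)].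
    Stated as a product, it needs no condition [sin x != 0]. *)
Lemma sum_cos_arith N x : 2 * sin x * \sum_(j < N.+1) cos (2 * x * j%:R) =
  sin (2 * x * N%:R + x) + sin x.
Proof.
elim: N => [|N IH]; first by rewrite big_ord1 !mulr0 cos0 add0r; ring.
rewrite big_ord_recr/= mulrDr IH.
have -> : 2 * x * N%:R + x = 2 * x * N.+1%:R - x by rewrite -(natr1 N); ring.
by rewrite sinB sinD; ring.
Qed.

Lemma sum_sin_arith N x : 2 * sin x * \sum_(j < N.+1) sin (2 * x * j%:R) =
  cos x - cos (2 * x * N%:R + x).
Proof.
elim: N => [|N IH]; first by rewrite big_ord1 !mulr0 sin0 add0r; ring.
rewrite big_ord_recr/= mulrDr IH.
have -> : 2 * x * N%:R + x = 2 * x * N.+1%:R - x by rewrite -(natr1 N); ring.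
by rewrite cosB cosD; ring.
Qed.

(** With the kernel as a sum of two squares, the two telescoped sums turn [4 sin^2 (C^2 + S^2)] into
    [2 - 2 cos (y + pi x)], which is at most 4. This controls the kernel away from the integers. *)
Lemma sin2_fejer_le N x : sin (pi * x) ^+ 2 * fejer N x <= N.+1%:R^-1.
Proof.
rewrite fejer_square_sum mulrCA ger_pMr ?invr_gt0 ?ltr0n// -(mulrA 2 pi x).
have := sum_cos_arith N (pi * x); have := sum_sin_arith N (pi * x).
set C := \sum_(j < _) cos _; set S := \sum_(j < _) sin _.
move: (2 * (pi * x) * N%:R + pi * x) => y hS hC.
have h : 4 * (sin (pi * x) ^+ 2 * (C ^+ 2 + S ^+ 2)) =
    2 - 2 * cos (y + pi * x).
  transitivity ((2 * sin (pi * x) * C) ^+ 2 + (2 * sin (pi * x) * S) ^+ 2).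
    by ring.
  rewrite hC hS cosD; have := cos2Dsin2 (pi * x); have := cos2Dsin2 y.
  lra.
by have := cos_geN1 (y + pi * x); lra.
Qed.

Lemma continuous_fejer N : continuous (@fejer R N).
Proof.
move=> x; apply: cvgM; first exact: cvg_cst.
apply: cvg_big => [|n _]; first exact: add_continuous.
apply: cvg_big => [|j _]; first exact: add_continuous.
apply: continuous_comp; last exact: continuous_cos.
apply: cvgM; last exact: cvg_cst.
by apply: cvgM; [exact: cvg_cst|exact: cvg_id].
Qed.

Lemma fejer_remainderN N x : fejer_remainder N (- x) = - fejer_remainder N x.
Proof.
rewrite /fejer_remainder -mulrN -sumrN; congr (_ * _); apply: eq_bigr => n _.
by rewrite -sumrN; apply: eq_bigr => k _; rewrite mulrN sinN mulNr.
Qed.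

Lemma fejer_remainderDr N x : fejer_remainder N (x + 1) = fejer_remainder N x.
Proof.
congr (_ * _); apply: eq_bigr => n _; apply: eq_bigr => k _.
by rewrite sin_2pi_natDr.
Qed.

Lemma fejer_primitiveN N x : fejer_primitive N (- x) = - fejer_primitive N x.
Proof. by rewrite /fejer_primitive fejer_remainderN opprD. Qed.

Lemma fejer_primitiveDr N x :
  fejer_primitive N (x + 1) = fejer_primitive N x + 1.
Proof. by rewrite /fejer_primitive fejer_remainderDr addrAC. Qed.

Lemma fejer_primitive0 N : fejer_primitive N 0 = 0 :> R.
Proof. by have := fejer_primitiveN N 0; rewrite oppr0; lra. Qed.

Lemma fejer_primitive1 N : fejer_primitive N 1 = 1 :> R.
Proof.
by have := fejer_primitiveDr N 0; rewrite add0r fejer_primitive0 add0r.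
Qed.

(** Oddness and the unit increment over a period, used at [- 2^-1], force this value for every [N].
    The limit of the primitive on ]0, 1[ is measured from this fixed point. *)
Lemma fejer_primitive_half N : fejer_primitive N 2^-1 = 2^-1 :> R.
Proof.
have := fejer_primitiveDr N (- 2^-1); rewrite fejer_primitiveN.
have -> : - 2^-1 + 1 = 2^-1 :> R by lra.
by lra.
Qed.

Global Instance is_derive_fejer_primitive N x :
  is_derive x 1 (@fejer_primitive R N) (fejer N x).
Proof.
rewrite fejerE.
(* The primitive is rewritten with operations on functions, the shape to which the derivation rules
   for sums and multiples apply. *)
have -> : @fejer_primitive R N = id \+ (fun x => N.+1%:R^-1 *
    (\sum_(n < N.+1) \sum_(k < n) (fun x =>
      sin (2 * pi * k.+1%:R * x) / (pi * k.+1%:R))) x).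
  apply/funext => y; rewrite /fejer_primitive /fejer_remainder /= fct_sumE.
  by under [in RHS]eq_bigr do rewrite fct_sumE.
apply: is_deriveD; apply: is_deriveZ; apply: is_derive_sum => n.
apply: is_derive_sum => k.
have -> : (fun y : R => sin (2 * pi * k.+1%:R * y) / (pi * k.+1%:R)) =
    (pi * k.+1%:R)^-1 \*: (sin \o ((2 * pi * k.+1%:R) \*: id)).
  by apply/funext => y /=; rewrite mulrC.
have -> : cos (2 * pi * k.+1%:R * x) *+ 2 = (pi * k.+1%:R)^-1 *:
    (cos (2 * pi * k.+1%:R * x) * (2 * pi * k.+1%:R *: 1)).
  have pi0 : pi != 0 :> R by rewrite gt_eqF// pi_gt0.
  have k0 : k.+1%:R != 0 :> R by rewrite pnatr_eq0.
  rewrite /GRing.scale/= mulr1 -mulr_natr.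
  by move: pi pi0 (k.+1%:R) k0 => p p0 m m0; field; rewrite m0 p0.
have h : is_derive x 1 ((2 * pi * k.+1%:R) \*: (id : R -> R))
    (2 * pi * k.+1%:R *: 1).
  exact: is_deriveZ.
have h1 := is_derive1_comp (is_derive_sin _) h.
exact: (is_deriveZ (pi * k.+1%:R)^-1 h1).
Qed.
End fejer_kernel.

(** * Integrals of the kernel and the limit of its primitive *)

Section fejer_integrals.
Context {R : realType}.
Implicit Types (N : nat) (x a b s : R).

Lemma continuous_fejer_primitive N : continuous (@fejer_primitive R N).
Proof.
move=> x; apply: differentiable_continuous; apply/derivable1_diffP.
exact: ex_derive.
Qed.

Lemma continuous_fejerB N s : continuous (fun x => fejer N (x - s)).
Proof.
move=> x; apply: (@continuous_comp _ _ _ (fun x => x - s) (fejer N)).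
  by apply: cvgB; [exact: cvg_id|exact: cvg_cst].
exact: continuous_fejer.
Qed.

Lemma continuous_integrable_itv (f : R -> R) a b : continuous f ->
  lebesgue_measure.-integrable `[a, b] (EFin \o f).
Proof.
move=> cf; apply: continuous_compact_integrable; first exact: segment_compact.
exact: continuous_subspaceT.
Qed.

Lemma is_derive_fejer_primitiveB N s x :
  is_derive x 1 (fun x => fejer_primitive N (x - s)) (fejer N (x - s)).
Proof.
rewrite -[fejer N _]mulr1.
have h : is_derive x 1 (fun x => x - s) 1.
  by rewrite -[X in is_derive _ _ _ X]subr0; apply: is_deriveB.
exact: (@is_derive1_comp _ (fejer_primitive N) (fun x => x - s)).
Qed.

Lemma Rintegral_fejerB N s a b : a <= b ->
  \int[lebesgue_measure]_(x in `[a, b]) fejer N (x - s) =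
  fejer_primitive N (b - s) - fejer_primitive N (a - s).
Proof.
(* The fundamental theorem of calculus is applied for [a < b]; a one-point interval is treated
   apart. *)
rewrite le_eqVlt => /predU1P[->|ab].
  by rewrite set_itv1 Rintegral_set1 subrr.
rewrite /Rintegral (@continuous_FTC2 _ _ (fun x => fejer_primitive N (x - s)))//.
- exact/continuous_subspaceT/continuous_fejerB.
- have c : continuous (fun x => fejer_primitive N (x - s)).
    move=> x; apply: (@continuous_comp _ _ _ (fun x => x - s)).
      by apply: cvgB; [exact: cvg_id|exact: cvg_cst].
    exact: continuous_fejer_primitive.
  split.
  + by move=> x _; have h := is_derive_fejer_primitiveB N s x; exact: ex_derive.
  + exact/cvg_at_right_filter/c.
  + exact/cvg_at_left_filter/c.
- move=> x _; rewrite derive1E; have h := is_derive_fejer_primitiveB N s x.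
  exact: derive_val.
Qed.

Lemma Rintegral_fejer_period N s :
  \int[lebesgue_measure]_(x in `[0, 1]) fejer N (x - s) = 1.
Proof.
rewrite Rintegral_fejerB//; have := fejer_primitiveDr N (- s).
by rewrite [- s + 1]addrC sub0r => ->; lra.
Qed.

Lemma nondecreasing_fejer_primitive N :
  {homo @fejer_primitive R N : x y / x <= y}.
Proof.
move=> x y xy; rewrite -subr_ge0 -[x]subr0 -[y]subr0 -Rintegral_fejerB//.
by apply: Rintegral_ge0 => z _; exact: fejer_ge0.
Qed.

Lemma fejer_primitive_onem N x :
  fejer_primitive N (1 - x) = 1 - fejer_primitive N x.
Proof. by rewrite addrC fejer_primitiveDr fejer_primitiveN addrC. Qed.

Lemma cvg_invS : (n.+1%:R^-1 : R) @[n --> \oo] --> (0 : R).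
Proof. exact: cvg_harmonic. Qed.

(** The gap [2^-1 - fejer_primitive N x] is the integral of the kernel over [[x, 2^-1]]. There
    [sin^2 (pi z)] has a positive minimum, so the kernel is of order [1 / (N + 1)] uniformly. *)
Lemma cvg_fejer_primitive_lehalf x : 0 < x <= 2^-1 ->
  fejer_primitive N x @[N --> \oo] --> (2^-1 : R).
Proof.
move=> /andP[x0 x12].
pose g z := sin (pi * z) ^+ 2 : R.
have cg : continuous g.
  move=> z; apply: (@continuous_comp _ _ _ (fun z => sin (pi * z)) (fun y => y ^+ 2)).
    apply: (@continuous_comp _ _ _ (fun z => pi * z)).
      by apply: cvgM; [exact: cvg_cst|exact: cvg_id].
    exact: continuous_sin.
  exact: exprn_continuous.
have [c] := EVT_min x12 (continuous_subspaceT cg).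
rewrite in_itv/= => /andP[xc c12] gc.
have gc0 : 0 < g c.
  rewrite exprn_gt0// sin_gt0_pi//; have p := pi_gt0 R; apply/andP; split.
    by rewrite mulr_gt0//; exact: lt_le_trans xc.
  by rewrite gtr_pMr//; lra.
have bound N : `|2^-1 - fejer_primitive N x| <= (g c)^-1 * N.+1%:R^-1.
  rewrite -{1}(fejer_primitive_half N) -[X in _ - fejer_primitive N X]subr0.
  rewrite -{1}[2^-1]subr0 -Rintegral_fejerB//.
  rewrite ger0_norm; last by apply: Rintegral_ge0 => z _; exact: fejer_ge0.
  apply: (@le_trans _ _ (\int[lebesgue_measure]_(z in `[x, 2^-1])
      ((g c)^-1 * N.+1%:R^-1))).
    apply: le_Rintegral => //.
    - exact/continuous_integrable_itv/continuous_fejerB.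
    - by apply: continuous_integrable_itv => z; exact: cvg_cst.
    move=> z /= zx; rewrite subr0 ler_pdivlMl//.
    apply: le_trans (sin2_fejer_le N z).
    by apply: ler_wpM2r; [exact: fejer_ge0|exact: gc].
  rewrite Rintegral_cst// [X in fine X](lebesgue_measure_itv `[x, 2^-1])/=.
  (* The interval has length [2^-1 - x], at most 1, or measure 0 when [x] equals [2^-1]. *)
  rewrite lte_fin; case: ifP => _ /=.
    rewrite ger_pMr; last by rewrite mulr_gt0// ?invr_gt0// ltr0n.
    by lra.
  by rewrite mulr0 mulr_ge0// ?invr_ge0 ?ltW.
apply/cvgrPdist_le => e e0.
have : (g c)^-1 * n.+1%:R^-1 @[n --> \oo] --> (g c)^-1 * 0.
  by apply: cvgM; [exact: cvg_cst|exact: cvg_invS].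
rewrite mulr0 => /cvgrPdist_le /(_ e e0); apply: filterS => N.
rewrite sub0r normrN => h; apply: le_trans (bound N) _.
exact: le_trans (ler_norm _) h.
Qed.

(** The reflection [x |-> 1 - x] sends ]1/2, 1[ into ]0, 1/2[ and fixes the limit 1/2. *)
Lemma cvg_fejer_primitive x : 0 < x < 1 ->
  fejer_primitive N x @[N --> \oo] --> (2^-1 : R).
Proof.
move=> /andP[x0 x1]; have [x12|x12] := leP x 2^-1.
  by apply: cvg_fejer_primitive_lehalf; rewrite x0.
have -> : (fun N => fejer_primitive N x) =
    (fun N => 1 - fejer_primitive N (1 - x)).
  by apply/funext => N; rewrite fejer_primitive_onem; lra.
rewrite (_ : nbhs (2^-1 : R) = nbhs (1 - 2^-1 : R)); last by congr nbhs; lra.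
apply: cvgB; first exact: cvg_cst.
by apply: cvg_fejer_primitive_lehalf; apply/andP; split; lra.
Qed.

End fejer_integrals.

(** * Integrals of uniformly bounded functions under a finite measure *)

Section bounded_convergence.
Context {d} {T : measurableType d} {R : realType}
  (mu : {finite_measure set T -> \bar R}).

Lemma integrable_bounded (D : set T) (f : T -> R) (M : R) : measurable D ->
  measurable_fun D f -> (forall x, D x -> `|f x| <= M) ->
  mu.-integrable D (EFin \o f).
Proof.
move=> mD mf fM; apply: measurable_bounded_integrable => //.
  by rewrite ltey_eq fin_num_measure.
exists M; split; rewrite ?num_real// => y My x Dx.
exact: le_trans (fM x Dx) (ltW My).
Qed.

Lemma bounded_cvg_Rintegral (D : set T) (f_ : nat -> T -> R) (f : T -> R)
    (M : R) : measurable D ->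
  (forall n, measurable_fun D (f_ n)) ->
  (forall n x, D x -> `|f_ n x| <= M) ->
  (forall x, D x -> f_ n x @[n --> \oo] --> f x) ->
  \int[mu]_(x in D) f_ n x @[n --> \oo] --> \int[mu]_(x in D) f x.
Proof.
move=> mD mf_ f_M f_f.
have [fi _ cvgf] : [/\ mu.-integrable D (EFin \o f),
    ((\int[mu]_(x in D) `|(f_ n x)%:E - (f x)%:E|)%E @[n --> \oo] --> 0%E) &
    ((\int[mu]_(x in D) (f_ n x)%:E)%E @[n --> \oo] -->
      (\int[mu]_(x in D) (f x)%:E)%E)].
  apply: (@dominated_convergence _ _ _ mu D mD _ _ (cst M%:E)).
  - by move=> n; exact/measurable_EFinP.
  - exact/measurable_EFinP/(measurable_fun_cvg mf_).
  - by apply: aeW => x Dx; apply: cvg_EFin; [exact: nearW|exact: f_f].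
  (* The sign of [M] is unknown, since [D] may be empty; hence the bound by its absolute value. *)
  - by apply: (integrable_bounded _ (cst M) `|M|) => //; rewrite /cst.
  - by apply: aeW => x n Dx; rewrite /= lee_fin f_M.
apply: fine_cvg; rewrite fineK//; exact: integrable_fin_num.
Qed.

Lemma Rintegral_indic (D A : set T) : measurable D -> measurable A ->
  \int[mu]_(x in D) \1_A x = fine (mu (A `&` D)).
Proof. by move=> mD mA; rewrite /Rintegral integral_indic. Qed.

End bounded_convergence.

(** * Exchange of the order of integration for bounded functions *)

Section exchange.
Context {d1 d2} {T1 : measurableType d1} {T2 : measurableType d2} {R : realType}
  (m1 : {sigma_finite_measure set T1 -> \bar R})
  (m2 : {sigma_finite_measure set T2 -> \bar R}).

(** Boundedness on a rectangle of finite measure gives the integrability required by Fubini.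
    Measurability of the inner integral is stated as well, because dominated convergence later needs
    it for the Fejer means. *)
Lemma Rintegral_exchange (D : set T1) (E : set T2) (h : T1 -> T2 -> R)
    (M : R) :
  measurable D -> measurable E -> (m1 D < +oo)%E -> (m2 E < +oo)%E ->
  measurable_fun setT (fun z => h z.1 z.2) ->
  (forall x y, D x -> E y -> `|h x y| <= M) ->
  measurable_fun E (fun y => \int[m1]_(x in D) h x y) /\
  \int[m1]_(x in D) \int[m2]_(y in E) h x y =
  \int[m2]_(y in E) \int[m1]_(x in D) h x y.
Proof.
move=> mD mE m1D m2E mh hM.
(* Extension by zero outside the rectangle, so that Fubini on the whole product space applies; [h1]
   and [h2] identify the inner integrals. *)
pose H := (fun z => (h z.1 z.2)%:E) \_ (D `*` E).
have mDE : measurable (D `*` E) by exact: measurableX.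
have iH : (m1 \x m2)%E.-integrable setT H.
  apply/(integrable_mkcond _ _).1 => //.
  apply: measurable_bounded_integrable => //.
  - rewrite [X in (X < _)%E](_ : _ = m1 D * m2 E)%E; last first.
      exact: product_measure1E.
    by rewrite lte_mul_pinfty// ge0_fin_numE.
  - exact: measurable_funTS.
  - exists M; split; rewrite ?num_real// => y My [x1 x2] [/= Dx Ex].
    exact: le_trans (hM x1 x2 Dx Ex) (ltW My).
have h1 x : (\int[m2]_y H (x, y))%E =
    ((fun x => \int[m2]_(y in E) (h x y)%:E) \_ D)%E x.
  rewrite patchE; case: ifPn => xD.
    rewrite [RHS]integral_mkcond; apply: eq_integral => y _.
    by rewrite /H !patchE /= in_setX xD.
  apply: integral0_eq => y _; rewrite /H patchE in_setX /=.
  by rewrite (negbTE xD).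
have h2 y : (\int[m1]_x H (x, y))%E =
    ((fun y => \int[m1]_(x in D) (h x y)%:E) \_ E)%E y.
  rewrite patchE; case: ifPn => yE.
    rewrite [RHS]integral_mkcond; apply: eq_integral => x _.
    by rewrite /H !patchE /= in_setX yE andbT.
  apply: integral0_eq => x _; rewrite /H patchE in_setX /=.
  by rewrite (negbTE yE) andbF.
have mDh y : measurable_fun D (h^~ y).
  apply: measurable_funTS.
  exact: (measurableT_comp mh (pair2_measurable y)).
have mEh x : measurable_fun E (h x).
  apply: measurable_funTS.
  exact: (measurableT_comp mh (pair1_measurable x)).
have ih1 x : D x -> m2.-integrable E (EFin \o h x).
  move=> Dx; apply: measurable_bounded_integrable => //.
  exists M; split; rewrite ?num_real// => y My z Ez.
  exact: le_trans (hM _ _ Dx Ez) (ltW My).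
have ih2 y : E y -> m1.-integrable D (EFin \o h^~ y).
  move=> Ey; apply: measurable_bounded_integrable => //.
  exists M; split; rewrite ?num_real// => z Mz x Dx.
  exact: le_trans (hM _ _ Dx Ey) (ltW Mz).
split.
  apply: measurableT_comp => //; apply/(measurable_restrictT _ mE).
  have := measurable_fubini_G iH; rewrite /fubini_G.
  by under eq_fun do rewrite h2.
have := Fubini iH.
under eq_integral do rewrite h1; under [in RHS]eq_integral do rewrite h2.
rewrite -!integral_mkcond => F; rewrite /Rintegral.
congr fine.
(* The inner integrals are finite, so passing through [fine] loses nothing. *)
under eq_integral => x /set_mem Dx do rewrite fineK ?integrable_fin_num ?ih1//.
under [RHS]eq_integral => y /set_mem Ey
  do rewrite fineK ?integrable_fin_num ?ih2//.
exact: F.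
Qed.
End exchange.

(** * Cesaro density, distribution function and measure in terms of the kernel *)

Section cesaro_fejer.
Context {R : realType}
  (mu : {finite_measure set (measurableTypeR R) -> \bar R}).
Implicit Types (N : nat) (f : R -> R) (t M s : R).

(** The bound may depend on [N]: it only serves integrability and Fubini at a fixed [N]. *)
Lemma fejer_bounded N : exists M, forall x : R, `|fejer N x| <= M.
Proof.
exists (N.+1%:R^-1 * \sum_(n < N.+1) \sum_(j < (2 * n).+1) 1) => x.
rewrite normrM ger0_norm ?invr_ge0// ler_wpM2l ?invr_ge0//.
apply: le_trans (ler_norm_sum _ _ _) _; apply: ler_sum => n _.
apply: le_trans (ler_norm_sum _ _ _) _; apply: ler_sum => j _; exact: cos_max.
Qed.

Lemma lebesgue_itv01_lty :
  (lebesgue_measure (`[0%R, 1%R]%classic : set R) < +oo)%E.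
Proof. by rewrite lebesgue_measure_itv/= lte_fin ltr01 -EFinB ltry. Qed.

Lemma measurable_fejerB N : measurable_fun setT
  (fun z : measurableTypeR R * measurableTypeR R => fejer N (z.1 - z.2)).
Proof.
apply: (@measurableT_comp _ _ _ _ _ _ (fejer N)).
  by apply: continuous_measurable_fun; exact: continuous_fejer.
by apply: measurable_funB; [exact: measurable_fst|exact: measurable_snd].
Qed.

Lemma cesaro_density_fejer N t :
  cesaro_density mu N t = \int[mu]_(s in `[0, 1]) fejer N (t - s).
Proof.
have [M fM] := fejer_bounded N.
rewrite cesaro_densityE -RintegralZl//.
apply: (@eq_integrable _ _ _ mu _ _
  (EFin \o (fun s => N.+1%:R * fejer N (t - s)))) => //.
  by move=> s _ /=; rewrite /fejer mulrA divff ?mul1r ?pnatr_eq0.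
apply: (@integrable_continuous_bounded _ mu _ (N.+1%:R * M)) => [s|s].
  apply: cvgM; first exact: cvg_cst.
  apply: (@continuous_comp _ _ _ (fun x => t - x) (fejer N)).
    by apply: cvgB; [exact: cvg_cst|exact: cvg_id].
  exact: continuous_fejer.
by rewrite normrM ger0_norm// ler_wpM2l.
Qed.

(** After Fubini, the lower limit 0 contributes [- fejer_primitive N (- s)], which oddness turns
    into the second summand. *)
Lemma cesaro_cdfE N t : 0 <= t -> cesaro_cdf mu N t =
  \int[mu]_(s in `[0, 1]) (fejer_primitive N (t - s) + fejer_primitive N s).
Proof.
move=> t0; have [M fM] := fejer_bounded N.
rewrite /cesaro_cdf; under eq_Rintegral do rewrite cesaro_density_fejer.
rewrite (proj2 (@Rintegral_exchange _ _ _ _ _ _ _ _ _ _ M _ _ _ _ _ _))//.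
- apply: eq_Rintegral => s _.
  by rewrite Rintegral_fejerB// sub0r fejer_primitiveN opprK.
- rewrite [X in (X < _)%E](lebesgue_measure_itv `[0, t])/=.
  by case: ifP => _; rewrite -?EFinB ltry.
- by rewrite ltey_eq fin_num_measure.
- exact: measurable_fejerB.
Qed.

(* The density is the Radon-Nikodym derivative of the Cesaro measure. *)
Lemma Rintegral_cesaro_measure N f M :
  measurable_fun (`[0, 1]%classic : set R) f ->
  (forall x, `[0, 1]%classic x -> `|f x| <= M) ->
  \int[cesaro_measure mu N]_(x in `[0, 1]) f x =
  \int[lebesgue_measure]_(x in `[0, 1]) (f x * cesaro_density mu N x).
Proof.
move=> mf fM; pose nu : {finite_measure set (measurableTypeR R) -> \bar R} :=
  cesaro_measure mu N.
have mrho : measurable_fun setT (cesaro_density mu N).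
  by apply: continuous_measurable_fun; exact: continuous_cesaro_density.
have numu : nu `<< lebesgue_measure.
  apply/null_content_dominatesP => A mA A0.
  have mAI : measurable (A `&` `[0, 1]%classic) by exact: measurableI.
  apply: null_set_integral => //.
    by apply/measurable_EFinP; exact: measurable_funTS.
  by apply/eqP; rewrite -measure_le0 -A0 le_measure// inE.
rewrite /Rintegral -[LHS]/(fine (\int[nu]_(x in `[0, 1]) (f x)%:E)).
rewrite -(@Radon_Nikodym_change_of_variables _ _ _ nu lebesgue_measure numu)//;
  last first.
  by apply: (@integrable_bounded _ _ _ nu _ f M).
congr fine; apply: ae_eq_integral => //.
- apply: emeasurable_funM; first exact/measurable_EFinP.
  exact: measurable_funTS.
- apply/measurable_EFinP; apply: measurable_funM => //; exact: measurable_funTS.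
(* Over each measurable subset of [0, 1] both functions integrate to its [nu]-measure, so they agree
   almost everywhere there. *)
suff : ae_eq lebesgue_measure `[0, 1]%classic
    (Radon_Nikodym (charge_of_finite_measure nu) lebesgue_measure)
    (EFin \o cesaro_density mu N).
  by apply: filterS => x /= RNx /RNx ->.
apply: integral_ae_eq => //.
- by apply: (integrableS measurableT) => //; exact: Radon_Nikodym_integrable.
- by apply/measurable_EFinP; exact: measurable_funTS.
- move=> E EI mE; rewrite -Radon_Nikodym_integral//.
  by rewrite /= /cesaro_measure (setIidl EI).
Qed.
End cesaro_fejer.

(** * Fejer means of a continuous function on [0, 1] and their limits *)

Definition fejer_mean {R : realType} (N : nat) (f : R -> R) (s : R) : R :=
  \int[lebesgue_measure]_(x in `[0, 1]) (f x * fejer N (x - s)).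

Section fejer_means.
Context {R : realType}.
Implicit Types (N : nat) (f g : R -> R) (s L M : R).

Lemma continuous_fejer_integrand N f s : continuous f ->
  continuous (fun x => f x * fejer N (x - s)).
Proof. by move=> cf x; apply: cvgM; [exact: cf|exact: continuous_fejerB]. Qed.

Lemma fejer_mean_cst N L s : fejer_mean N (fun=> L) s = L.
Proof.
rewrite /fejer_mean RintegralZl//; first by rewrite Rintegral_fejer_period mulr1.
exact/continuous_integrable_itv/continuous_fejerB.
Qed.

(** The shape of the hypothesis fits the kernel: the constant [e] is preserved because the kernel
    has mass 1, and the [sin^2] term gains the factor [1 / (N + 1)] from [sin2_fejer_le]. *)
Lemma fejer_mean_dist_le N f s L (e C : R) : continuous f ->
  (forall x : R, 0 <= x <= 1 -> `|f x - L| <= e + C * sin (pi * (x - s)) ^+ 2) ->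
  0 <= C -> `|fejer_mean N f s - L| <= e + C * N.+1%:R^-1.
Proof.
move=> cf fL C0.
have icst (c : R) : lebesgue_measure.-integrable (`[0, 1]%classic : set R)
    (EFin \o (fun=> c)).
  by apply: continuous_integrable_itv => x; exact: cvg_cst.
have ieK : lebesgue_measure.-integrable (`[0, 1]%classic : set R)
    (EFin \o (fun x => e * fejer N (x - s))).
  apply: continuous_integrable_itv; apply: continuous_fejer_integrand => x.
  exact: cvg_cst.
rewrite -{1}(fejer_mean_cst N L s) /fejer_mean -RintegralB//; first last.
- apply/continuous_integrable_itv/continuous_fejer_integrand => x; exact: cvg_cst.
- exact/continuous_integrable_itv/continuous_fejer_integrand.
have cfL : continuous (fun x => f x * fejer N (x - s) - L * fejer N (x - s)).
  move=> x; apply: cvgB; first exact: continuous_fejer_integrand.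
  by apply: cvgM; [exact: cvg_cst|exact: continuous_fejerB].
apply: le_trans (le_normr_Rintegral _ _) _ => //.
  exact: continuous_integrable_itv.
apply: (@le_trans _ _ (\int[lebesgue_measure]_(x in `[0, 1])
    (e * fejer N (x - s) + C * N.+1%:R^-1))).
  apply: le_Rintegral => //.
  - apply: continuous_integrable_itv => x.
    by apply: cvg_norm; exact: cfL.
  - apply: continuous_integrable_itv => x; apply: cvgD; last exact: cvg_cst.
    by apply: cvgM; [exact: cvg_cst|exact: continuous_fejerB].
  move=> x /=; rewrite in_itv/= => x01.
  rewrite -mulrBl normrM (ger0_norm (fejer_ge0 _ _)).
  apply: le_trans (ler_wpM2r (fejer_ge0 _ _) (fL x x01)) _.
  by rewrite mulrDl lerD2l -mulrA ler_wpM2l// sin2_fejer_le.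
rewrite RintegralD// Rintegral_cst// [X in fine X](lebesgue_measure_itv `[0, 1])/=.
rewrite lte_fin ltr01 oppr0 adde0/= mulr1 lerD2r.
by rewrite -/(fejer_mean N (fun=> e) s) fejer_mean_cst.
Qed.

Lemma cvg_fejer_mean f s L : continuous f ->
  (forall e : R, 0 < e -> exists2 C : R, 0 <= C & forall x : R, 0 <= x <= 1 ->
    `|f x - L| <= e + C * sin (pi * (x - s)) ^+ 2) ->
  fejer_mean N f s @[N --> \oo] --> L.
Proof.
move=> cf fL; apply/cvgrPdist_le => e e0.
have e20 : 0 < e / 2 by rewrite divr_gt0.
have [C C0 fC] := fL _ e20.
have : C * n.+1%:R^-1 @[n --> \oo] --> C * 0.
  by apply: cvgM; [exact: cvg_cst|exact: cvg_invS].
rewrite mulr0 => /cvgrPdist_le /(_ _ e20); apply: filterS => N.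
rewrite sub0r normrN distrC => /(le_trans (ler_norm _)) h.
apply: le_trans (fejer_mean_dist_le N _ _ _ _ _ cf fC C0) _.
by rewrite [leRHS]splitr lerD2l.
Qed.

(** Reduces the hypothesis of [cvg_fejer_mean] to the values of [f] at the zeros of the sine in
    [0, 1]: the single point [s] if [s] is interior, both endpoints if [s] is 0. *)
Lemma continuous_dist_le_sin2 f s L (e : R) : continuous f -> 0 < e ->
  (forall x : R, 0 <= x <= 1 -> sin (pi * (x - s)) = 0 -> f x = L) ->
  exists2 C : R, 0 <= C & forall x : R, 0 <= x <= 1 ->
    `|f x - L| <= e + C * sin (pi * (x - s)) ^+ 2.
Proof.
move=> cf e0 fL.
have cfL : continuous (fun x => `|f x - L|).
  by move=> x; apply: cvg_norm; apply: cvgB; [exact: cf|exact: cvg_cst].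
(* g > 0 on [0, 1], so its minimum there bounds sin^2 from below wherever
   |f - L| >= e. *)
pose g x := sin (pi * (x - s)) ^+ 2 + Num.max (e - `|f x - L|) 0.
have cg : continuous g.
  move=> x; apply: cvgD.
    apply: (@continuous_comp _ _ _ (fun x => sin (pi * (x - s))) (fun y => y ^+ 2));
      last exact: exprn_continuous.
    apply: (@continuous_comp _ _ _ (fun x => pi * (x - s))); last exact: continuous_sin.
    by apply: cvgM; [exact: cvg_cst|apply: cvgB; [exact: cvg_id|exact: cvg_cst]].
  have : {for x, continuous ((fun y => e - `|f y - L|) \max (fun=> 0 : R))}.
    apply: continuous_max; last exact: cvg_cst.
    by apply: cvgB; [exact: cvg_cst|exact: cfL].
  exact.
have [b _ bB] := EVT_max (@ler01 R) (continuous_subspaceT cfL).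
have [c] := EVT_min (@ler01 R) (continuous_subspaceT cg).
rewrite in_itv/= => c01 gc.
have gc0 : 0 < g c.
  (* At a zero of the sine [f c = L], so the second summand of [g c] is [e]; elsewhere the square is
     already positive. *)
  have [h|h] := eqVneq (sin (pi * (c - s))) 0.
    by rewrite /g h (fL c)// subrr normr0 subr0 expr0n add0r lt_max e0.
  rewrite /g ltr_wpDr// ?le_max ?lexx ?orbT//.
  by rewrite lt_neqAle sqr_ge0 eq_sym sqrf_eq0 h.
(* The maximum of [|f - L|] over the minimum of [g]. *)
exists (`|f b - L| / g c); first by rewrite divr_ge0// ltW.
move=> x x01; have [xe|ex] := leP `|f x - L| e.
  by rewrite ler_wpDr// mulr_ge0 ?sqr_ge0// divr_ge0// ltW.
have := gc x; rewrite in_itv/= => /(_ x01).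
rewrite {2}/g max_r ?addr0; last by rewrite subr_le0 ltW.
move=> gx; apply: (@le_trans _ _ (`|f b - L| / g c * g c)).
  by rewrite mulfVK ?gt_eqF//; apply: bB; rewrite in_itv.
apply: ler_wpDl; first exact: ltW.
by apply: ler_wpM2l => //; rewrite divr_ge0// ltW.
Qed.

Lemma sin_pi_eq0 (x : R) : -1 < x < 1 -> sin (pi * x) = 0 -> x = 0.
Proof.
have p := pi_gt0 R.
have pos (y : R) : 0 < y < 1 -> sin (pi * y) != 0.
  move=> /andP[y0 y1]; rewrite gt_eqF// sin_gt0_pi// mulr_gt0//=.
  by rewrite gtr_pMr.
move=> /andP[x1 x2] /eqP; have [x0|x0|//] := ltgtP x 0.
- rewrite -oppr_eq0 -sinN -mulrN => h.
  have /pos : 0 < - x < 1 by apply/andP; split; lra.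
  by rewrite h.
- by have /pos/negbTE -> : 0 < x < 1 by rewrite x0.
Qed.

Lemma cvg_fejer_mean_oo f s : continuous f -> 0 < s < 1 ->
  fejer_mean N f s @[N --> \oo] --> f s.
Proof.
move=> cf /andP[s0 s1]; apply: cvg_fejer_mean => // e e0.
apply: continuous_dist_le_sin2 => // x /andP[x0 x1] /sin_pi_eq0 h.
by congr f; apply/eqP; rewrite -subr_eq0 h//; apply/andP; split; lra.
Qed.

(** Substitution of [1 - x] for [x]: by periodicity and evenness the kernel is invariant. *)
Lemma fejer_mean_reflect N f : continuous f ->
  fejer_mean N f 0 = fejer_mean N (fun x => f (1 - x)) 0.
Proof.
move=> cf; rewrite /fejer_mean Rintegration_by_substitution_onem ?ler01 ?lexx//.
  rewrite /unstable.onem subrr; apply: eq_Rintegral => x _; rewrite !subr0.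
  congr (_ * _).
  by rewrite addrC fejerDr fejerN.
exact/continuous_subspaceT/continuous_fejer_integrand.
Qed.

Lemma cvg_fejer_mean0 f : continuous f ->
  fejer_mean N f 0 @[N --> \oo] --> (f 0 + f 1) / 2.
Proof.
move=> cf.
(* By the reflection symmetry of K_N, f may be replaced by the symmetrized g,
   which takes the value (f 0 + f 1) / 2 at both endpoints. *)
pose g x := 2^-1 * (f x + f (1 - x)).
have cf' : continuous (fun x : R => f (1 - x)).
  move=> x; apply: (@continuous_comp _ _ _ (fun y : R => 1 - y) f); last exact: cf.
  by apply: cvgB; [exact: cvg_cst|exact: cvg_id].
have cg : continuous g.
  by move=> x; apply: cvgM; [exact: cvg_cst|apply: cvgD; [exact: cf|exact: cf']].
have -> : (fun N => fejer_mean N f 0) = (fun N => fejer_mean N g 0).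
  apply/funext => N; transitivity (2^-1 * (fejer_mean N f 0 + fejer_mean N f 0)).
    by lra.
  rewrite {2}fejer_mean_reflect// /fejer_mean -RintegralD//; first last.
  - exact/continuous_integrable_itv/continuous_fejer_integrand.
  - exact/continuous_integrable_itv/continuous_fejer_integrand.
  rewrite -RintegralZl//; last first.
    apply: continuous_integrable_itv => x.
    by apply: cvgD; exact: continuous_fejer_integrand.
  by apply: eq_Rintegral => x _; rewrite -mulrDl mulrA.
apply: cvg_fejer_mean => // e e0.
apply: continuous_dist_le_sin2 => // x /andP[x0 x1].
(* The sine also vanishes at 1, which lies outside the range of [sin_pi_eq0]. *)
rewrite subr0; have [->|x1'] := eqVneq x 1.
  by move=> _; rewrite /g subrr; lra.
move=> /sin_pi_eq0 ->; first by rewrite /g subr0; lra.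
by apply/andP; split; [lra|rewrite lt_neqAle x1'].
Qed.

Lemma fejer_mean1 N f : fejer_mean N f 1 = fejer_mean N f 0.
Proof.
apply: eq_Rintegral => x _; rewrite subr0; congr (_ * _).
by rewrite -fejerDr subrK.
Qed.

(** The case [L = 0], [C = 0] of [fejer_mean_dist_le]. The bound is uniform in [N], as dominated
    convergence demands. *)
Lemma fejer_mean_bounded N f s M : continuous f -> 0 <= M ->
  (forall x : R, 0 <= x <= 1 -> `|f x| <= M) -> `|fejer_mean N f s| <= M.
Proof.
move=> cf M0 fM; have := fejer_mean_dist_le N f s 0 M 0 cf.
rewrite subr0 mul0r addr0; apply => // x x01.
by rewrite subr0 mul0r addr0 fM.
Qed.

End fejer_means.

(** * Endpoint atoms and the limit of the distribution functions *)

Lemma indic_set1 {R : realType} (a s : R) : \1_[set a] s = (s == a)%R%:R :> R.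
Proof.
rewrite indicE; congr (_ %:R); congr nat_of_bool.
by apply/idP/eqP; rewrite inE.
Qed.

Section endpoints.
Context {R : realType}
  (mu : {finite_measure set (measurableTypeR R) -> \bar R}).

(** The added term integrates to [c] times the difference of two equal masses. An integrand may thus
    be shifted by opposite amounts at 0 and 1 to match a pointwise limit. *)
Lemma Rintegral_endpoints (u : R -> R) (c M : R) : mu [set 0] = mu [set 1] ->
  measurable_fun (`[0, 1]%classic : set R) u ->
  (forall x, `[0, 1]%classic x -> `|u x| <= M) ->
  \int[mu]_(x in `[0, 1]) (u x + c * (\1_[set 1] x - \1_[set 0] x)) =
  \int[mu]_(x in `[0, 1]) u x.
Proof.
move=> mu01 mf fM.
have i1 (a : R) : mu.-integrable `[0, 1]%classic (EFin \o \1_[set a]).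
  apply: (@integrable_bounded _ _ _ mu _ _ 1) => // x _.
  by rewrite ger0_norm ?indicE// lern1 leq_b1.
have i2 : mu.-integrable `[0, 1]%classic
    (EFin \o (fun x => \1_[set 1] x - \1_[set 0] x : R)).
  exact: (integrableB _ (i1 1) (i1 0)).
rewrite RintegralD//; first last.
- exact: (integrableZl _ c i2).
- exact: (@integrable_bounded _ _ _ mu _ _ M).
rewrite RintegralZl// RintegralB// !Rintegral_indic//.
have -> : [set 1] `&` `[0, 1]%classic = [set 1] :> set R.
  by apply/setIidl => x ->; rewrite /= in_itv/= ler01 lexx.
have -> : [set 0] `&` `[0, 1]%classic = [set 0] :> set R.
  by apply/setIidl => x ->; rewrite /= in_itv/= ler01 lexx.
by rewrite mu01 subrr mulr0 addr0.
Qed.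

Lemma cvg_cesaro_cdf (t : R) : mu [set 0] = mu [set 1] -> 0 < t < 1 ->
  cesaro_cdf mu N t @[N --> \oo] --> (cdf01 mu t + cdf01_left mu t) / 2.
Proof.
move=> mu01 /andP[t0 t1].
(* [u] is 1 on [0, t[, 1/2 at [t] and 0 on ]t, 1], so its integral is the desired mean. [h] changes
   its values at 0 and 1 to 1/2, which makes it the pointwise limit on all of [0, 1]. *)
pose u (s : R) : R := 2^-1 * (\1_`[0, t] s + \1_`[0, t[ s).
pose h (s : R) : R := u s + 2^-1 * (\1_[set 1] s - \1_[set 0] s).
have hE s : h s = 2^-1 * ((0 <= s <= t)%R%:R + (0 <= s < t)%R%:R) +
    2^-1 * ((s == 1)%R%:R - (s == 0)%R%:R).
  by rewrite /h /u !indic_set1 !indicE !mem_setE !in_itv.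
have ind1 (A : set R) (s : R) : `|\1_A s : R| <= 1.
  by rewrite ger0_norm ?indicE// lern1 leq_b1.
have -> : (cdf01 mu t + cdf01_left mu t) / 2 = \int[mu]_(s in `[0, 1]) h s.
  rewrite (Rintegral_endpoints u 2^-1 1 mu01); first last.
  - move=> x _; rewrite /u normrM ger0_norm// ler_pdivrMl// mulr1.
    by rewrite (le_trans (ler_normD _ _))// -[2]/(1 + 1) lerD.
  - by apply: measurable_funM => //; apply: measurable_funD => //;
      apply: measurable_funTS; exact: measurable_indic.
  have i1 (A : set R) : measurable A ->
      mu.-integrable `[0, 1]%classic (EFin \o \1_A).
    by move=> mA; apply: (@integrable_bounded _ _ _ mu _ _ 1).
  rewrite RintegralZl//; last exact: (integrableD _ (i1 _ _) (i1 _ _)).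
  rewrite RintegralD// ?Rintegral_indic//; [|exact: i1|exact: i1].
  rewrite mulrC /cdf01 /cdf01_left; congr (_ * (fine (mu _) + fine (mu _))).
  - by apply/esym/setIidl => x /=; rewrite !in_itv/= => /andP[-> xt]; lra.
  - by apply/esym/setIidl => x /=; rewrite !in_itv/= => /andP[-> xt]; lra.
have -> : (fun N => cesaro_cdf mu N t) = (fun N => \int[mu]_(s in `[0, 1])
    (fejer_primitive N (t - s) + fejer_primitive N s)).
  by apply/funext => N; rewrite cesaro_cdfE// ltW.
apply: (bounded_cvg_Rintegral mu _
  (fun N s => fejer_primitive N (t - s) + fejer_primitive N s) h 2) => //.
- move=> N; apply: measurable_funTS; apply: continuous_measurable_fun => x.
  apply: cvgD; last exact: continuous_fejer_primitive.
  apply: (@continuous_comp _ _ _ (fun y : R => t - y)).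
    by apply: cvgB; [exact: cvg_cst|exact: cvg_id].
  exact: continuous_fejer_primitive.
- move=> N s; rewrite /= in_itv/= => s01; have /andP[s0 s1] := s01.
  (* Monotonicity and the values -1 and 1 at the ends of [-1, 1]; two such terms give the dominating
     constant 2. *)
  have p1 (x : R) : -1 <= x <= 1 -> `|fejer_primitive N x| <= 1.
    move=> /andP[x0 x1]; rewrite ler_norml -[-1]opprK !opprK.
    rewrite -{1}(fejer_primitive1 N) -fejer_primitiveN.
    rewrite nondecreasing_fejer_primitive//=.
    by have := nondecreasing_fejer_primitive N _ _ x1; rewrite fejer_primitive1.
  apply: le_trans (ler_normD _ _) _; rewrite -[2]/(1 + 1).
  by apply: lerD; apply: p1; apply/andP; split; lra.
move=> s; rewrite /= in_itv/= => /andP[s0 s1].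
have cP := @cvg_fejer_primitive R.
have [s0'|s0'] := eqVneq s 0.
  have -> : h s = 2^-1 + 0.
    by rewrite hE s0' lexx eqxx ltW//= t0 eq_sym oner_eq0/=; lra.
  rewrite s0' subr0; apply: cvgD; first by apply: cP; rewrite t0.
  by under eq_fun do rewrite fejer_primitive0; exact: cvg_cst.
have [s1'|s1'] := eqVneq s 1.
  have -> : h s = 2^-1.
    by rewrite hE s1' ler01 eqxx oner_eq0 leNgt t1 ltNge ltW//=; lra.
  (* At [s = 1] the second term is exactly 1, and the unit increment merges the sum into
     [fejer_primitive N t]. *)
  have -> : (fun N => fejer_primitive N (t - s) + fejer_primitive N s) =
      (fun N => fejer_primitive N t).
    apply/funext => N; rewrite s1' fejer_primitive1 -fejer_primitiveDr.
    by rewrite subrK.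
  by apply: cP; rewrite t0.
have cs : fejer_primitive N s @[N --> \oo] --> (2^-1 : R).
  by apply: cP; rewrite !lt_neqAle eq_sym s0' s0 s1' s1.
have [st|st|st] := ltgtP s t.
- have -> : h s = 2^-1 + 2^-1.
    by rewrite hE s0 (negbTE s0') (negbTE s1') st ltW//=; lra.
  by apply: cvgD => //; apply: cP; apply/andP; split; lra.
(* Here [t - s] is negative, and oddness produces the limit -1/2. *)
- have -> : h s = - 2^-1 + 2^-1.
    rewrite hE s0 (negbTE s0') (negbTE s1') [s <= t]leNgt st [s < t]ltNge.
    by rewrite (ltW st)/=; lra.
  apply: cvgD => //; under eq_fun do rewrite -opprB fejer_primitiveN.
  by apply: cvgN; apply: cP; apply/andP; split; lra.
- have -> : h s = 0 + 2^-1.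
    by rewrite hE s0 (negbTE s0') (negbTE s1') st lexx ltxx/=; lra.
  rewrite st subrr; apply: cvgD; last by rewrite -st.
  by under eq_fun do rewrite fejer_primitive0; exact: cvg_cst.
Qed.

End endpoints.

(** * Weak convergence, with test functions extended from [0, 1] to the line *)

Definition clamp01 {R : realType} (x : R) : R := Num.max 0 (Num.min 1 x).

Section weak_convergence.
Context {R : realType}.

Lemma clamp01_itv (x : R) : 0 <= clamp01 x <= 1.
Proof. by rewrite /clamp01 le_max lexx/= ge_max ler01 ge_min lexx. Qed.

Lemma clamp01_id (x : R) : 0 <= x <= 1 -> clamp01 x = x.
Proof. by move=> /andP[x0 x1]; rewrite /clamp01 min_r// max_r. Qed.

Lemma continuous_clamp01 : continuous (@clamp01 R).
Proof.
move=> x.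
have h : {for x, continuous ((fun=> 0 : R) \max ((fun=> 1 : R) \min id))}.
  apply: continuous_max; first exact: cvg_cst.
  by apply: continuous_min; [exact: cvg_cst|exact: cvg_id].
exact: h.
Qed.

(** [clamp01] is a continuous retraction onto [0, 1], so only neighbourhoods within the interval
    matter. The composite extends [f] to a function continuous on the whole line, as the lemmas on
    Fejer means require. *)
Lemma continuous_comp_clamp01 (f : R -> R) :
  {within `[0, 1], continuous f} -> continuous (f \o clamp01).
Proof.
move=> cf x.
have ci (y : R) : `[0, 1]%classic (clamp01 y) by rewrite /= in_itv/= clamp01_itv.
have /subspace_continuousP/(_ _ (ci x)) fx := cf.
apply: (@cvg_comp _ _ _ clamp01 f _ (within `[0, 1]%classic (nbhs (clamp01 x)))) => //.
move=> B wB.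
have h : nbhs x (clamp01 @^-1` [set z | `[0, 1]%classic z -> B z]).
  exact: (continuous_clamp01 x _ wB).
by apply: (filterS _ h) => y By; exact: (By (ci y)).
Qed.

Lemma weak_cvg_cesaro_measure
    (mu : {finite_measure set (measurableTypeR R) -> \bar R}) :
  mu [set 0] = mu [set 1] ->
  weak_cvg_on `[0, 1]%classic (fun N => cesaro_measure mu N) mu.
Proof.
move=> mu01 f cf [M fM].
pose g := f \o clamp01.
have cg : continuous g by exact: continuous_comp_clamp01.
have fg (x : R) : x \in `[0, 1]%classic -> f x = g x.
  by rewrite inE/= in_itv/= => x01; rewrite /g /= clamp01_id.
have gM (x : R) : `|g x| <= M by apply: fM; rewrite /= in_itv/= clamp01_itv.
have M0 : 0 <= M := le_trans (normr_ge0 _) (gM 0).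
have mg (D : set R) : measurable_fun D g.
  by apply: measurable_funTS; exact: continuous_measurable_fun.
(* Fubini moves the kernel from [mu] to the test function: integrating [g] against the Cesaro
   measure is integrating its Fejer mean against [mu]. *)
have exchange N :
    measurable_fun (`[0, 1]%classic : set R) (fejer_mean N g) /\
    \int[cesaro_measure mu N]_(x in `[0, 1]) f x =
    \int[mu]_(s in `[0, 1]) fejer_mean N g s.
  have -> : \int[cesaro_measure mu N]_(x in `[0, 1]) f x =
      \int[cesaro_measure mu N]_(x in `[0, 1]) g x by exact: eq_Rintegral.
  rewrite (Rintegral_cesaro_measure _ _ _ M)//.
  have [K fK] := @fejer_bounded R N.
  have muI : (mu `[0%R, 1%R]%classic < +oo)%E by rewrite ltey_eq fin_num_measure.
  have mgK : measurable_fun setT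
      (fun z : measurableTypeR R * measurableTypeR R => g z.1 * fejer N (z.1 - z.2)).
    apply: measurable_funM; last exact: measurable_fejerB.
    exact: (measurableT_comp (mg setT) measurable_fst).
  have gK (x s : R) : `[0, 1]%classic x -> `[0, 1]%classic s ->
      `|g x * fejer N (x - s)| <= M * K.
    by move=> _ _; rewrite normrM ler_pM.
  have [mG GE] := Rintegral_exchange lebesgue_measure mu _ _
    (fun x s => g x * fejer N (x - s)) (M * K)
    (measurable_itv _) (measurable_itv _) lebesgue_itv01_lty muI mgK gK.
  split; first exact: mG.
  rewrite -GE; apply: eq_Rintegral => x _; rewrite cesaro_density_fejer.
  rewrite RintegralZl//.
  apply: (@integrable_bounded _ _ _ mu _ _ K) => //.
  apply: measurable_funTS.
  exact: (measurableT_comp (measurable_fejerB N) (pair1_measurable x)).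
have -> : (fun N => \int[cesaro_measure mu N]_(x in `[0, 1]) f x) =
    (fun N => \int[mu]_(s in `[0, 1]) fejer_mean N g s).
  by apply/funext => N; have [] := exchange N.
have -> : \int[mu]_(x in `[0, 1]) f x = \int[mu]_(x in `[0, 1]) g x.
  exact: eq_Rintegral.
(* This coefficient turns both [g 0] and [g 1] into their mean, the limit of the Fejer means at the
   endpoints. *)
rewrite -(Rintegral_endpoints mu g ((g 0 - g 1) / 2) M mu01)//.
apply: (bounded_cvg_Rintegral mu _ (fun N => fejer_mean N g) _ M) => //.
- by move=> N; have [] := exchange N.
- by move=> N s _; exact: fejer_mean_bounded.
move=> s; rewrite /= in_itv/= => /andP[s0 s1].
have -> : g s + (g 0 - g 1) / 2 * (\1_[set 1] s - \1_[set 0] s) =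
    if (s == 0) || (s == 1) then (g 0 + g 1) / 2 else g s.
  rewrite !indic_set1; have [->|_] := eqVneq s 0.
    by rewrite [0 == 1]eq_sym oner_eq0/=; lra.
  by have [->|_] := eqVneq s 1; rewrite /=; lra.
have [->|s0'] := eqVneq s 0; first exact: cvg_fejer_mean0.
have [->|s1'] := eqVneq s 1.
  by under eq_fun do rewrite fejer_mean1; exact: cvg_fejer_mean0.
by apply: cvg_fejer_mean_oo => //; rewrite !lt_neqAle eq_sym s0' s0 s1' s1.
Qed.
End weak_convergence.

Theorem theorem3 (R : realType)
    (mu : {finite_measure set (measurableTypeR R) -> \bar R})
    (mu_supp : mu (~` `[0, 1]%classic) = 0%E)
    (mu_01 : mu [set 0] = mu [set 1]) :
  [/\ forall N : nat, cesaro_cdf mu N 0 = 0,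
      forall N : nat, cesaro_cdf mu N 1 = fine (mu `[0, 1]%classic),
      forall t : R, 0 < t < 1 ->
        cesaro_cdf mu N t @[N --> \oo] --> (cdf01 mu t + cdf01_left mu t) / 2
    & weak_cvg_on `[0, 1]%classic (fun N => cesaro_measure mu N) mu].
Proof.
split.
- by move=> N; rewrite /cesaro_cdf set_itv1 Rintegral_set1.
(* For [t = 1] the integrand of [cesaro_cdfE] is identically 1, by [fejer_primitive_onem]. *)
- move=> N; rewrite cesaro_cdfE// -[RHS]mul1r -Rintegral_cst//.
  by apply: eq_Rintegral => s _; rewrite fejer_primitive_onem subrK.
- by move=> t; exact: cvg_cesaro_cdf.
- exact: weak_cvg_cesaro_measure.
Qed.
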